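(* Let $T,n,m,N_u$, $\mathbf{W}_1,\mathbf{W}_2,\tilde{\mathbf{D}},\boldsymbol{\Theta}_t,\boldsymbol{\nu}$ and their rows be as in the context. The problem $$\max\ \log\det\mathbf{E}$$ over symmetric $\mathbf{E}\succeq0$, $\mathbf{e}\in\mathbb{R}^T$, $\mathbf{K}\in\mathbb{R}^{(n-1)T\times T}$, $\mathbf{L}_t\in\mathbb{R}^{(n-1)T\times N_u}$ ($t=1,\dots,T$), $\boldsymbol{\gamma}\in\mathbb{R}^{(n-1)T}$, $\alpha_1,\dots,\alpha_m\in\mathbb{R}$, subject to, for all $i=1,\dots,m$, $$\big\|\mathbf{w}_{1,i}\tilde{\mathbf{D}}^{-1}\mathbf{E}+\mathbf{w}_{2,i}\mathbf{K}\big\|+\sum_{k=1}^T\big\|\mathbf{w}_{2,i}\mathbf{L}_k-\boldsymbol{\theta}_{k,i}\big\|\le\alpha_i,$$ $$\alpha_i+\mathbf{w}_{1,i}\tilde{\mathbf{D}}^{-1}\mathbf{e}+\mathbf{w}_{2,i}\boldsymbol{\gamma}-\nu_i\le0,$$ is an (exact) reformulation of the robust problem $$\max_{\mathbf{E}\succeq0,\ \mathbf{e},\ \mathbf{K},\ \{\mathbf{L}_t\},\ \boldsymbol{\gamma}}\Big\{\log\det\mathbf{E}:\ \mathbf{W}_1\tilde{\mathbf{D}}^{-1}(\mathbf{E}\boldsymbol{\xi}+\mathbf{e})+\mathbf{W}_2\Big(\mathbf{K}\boldsymbol{\xi}+\sum_{t=1}^T\mathbf{L}_t\boldsymbol{\zeta}_t+\boldsymbol{\gamma}\Big)\le\sum_{t=1}^T\boldsymbol{\Theta}_t\boldsymbol{\zeta}_t+\boldsymbol{\nu}\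 \ \ \forall\,\|\boldsymbol{\xi}\|\le1,\ \forall\,\|\boldsymbol{\zeta}_t\|\le1,\ t=1,\dots,T\Big\}$$ obtained by imposing the affine policy $\mathbf{y}=\mathbf{K}\boldsymbol{\xi}+\sum_{t=1}^T\mathbf{L}_t\boldsymbol{\zeta}_t+\boldsymbol{\gamma}$ on the adaptive robust problem of the context. That is, $(\mathbf{E},\mathbf{e},\mathbf{K},\{\mathbf{L}_t\},\boldsymbol{\gamma})$ is feasible for the latter problem if and only if there exist $\alpha_1,\dots,\alpha_m$ such that $(\mathbf{E},\mathbf{e},\mathbf{K},\{\mathbf{L}_t\},\boldsymbol{\gamma},\{\alpha_i\})$ is feasible for the former.
   Context: $T,n,m$ are positive integers and $N_u=3$ is the dimension of each uncertainty vector $\boldsymbol{\zeta}_t$. $\|\cdot\|$ is the Euclidean norm (of row or column vectors), vector inequalities are componentwise, $\mathbf{E}\succeq0$ means $\mathbf{E}\in\mathbb{R}^{T\times T}$ is symmetric positive semidefinite, and $\log\det\mathbf{E}=-\infty$ if $\mathbf{E}$ is singular. Data. $\mathbf{W}\in\mathbb{R}^{m\times nT}$ is a constant matrix; $\mathbf{D}\in\mathbb{R}^{T\times nT}$ is a constant matrix whose $t$-th row has nonzero entries only in columns corresponding to time $t$ and which has rank $T$; $\mathbf{z}(\boldsymbol{\zeta})\in\mathbb{R}^m$ and $\mathbf{b}(\boldsymbol{\zeta})\in\mathbb{R}^T$ are affine functions of $\boldsymbol{\zeta}=(\boldsymbol{\zeta}_1,\dots,\boldsymbol{\zeta}_T)$,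 $\boldsymbol{\zeta}_t\in\mathbb{R}^{N_u}$. Let $\mathbf{b}^1,\dots,\mathbf{b}^{nT}$ be an orthogonal basis of $\mathbb{R}^{nT}$ with $\mathbf{b}^{T+1},\dots,\mathbf{b}^{nT}$ spanning the null space of $\mathbf{D}$; $\mathbf{B}_1=[\mathbf{b}^1\cdots\mathbf{b}^T]$, $\mathbf{B}_2=[\mathbf{b}^{T+1}\cdots\mathbf{b}^{nT}]$, $\tilde{\mathbf{D}}=\mathbf{D}\mathbf{B}_1$ (nonsingular), $\mathbf{W}_1=\mathbf{W}\mathbf{B}_1\in\mathbb{R}^{m\times T}$, $\mathbf{W}_2=\mathbf{W}\mathbf{B}_2\in\mathbb{R}^{m\times(n-1)T}$. The affine function $\mathbf{u}(\boldsymbol{\zeta})=\mathbf{z}(\boldsymbol{\zeta})+\mathbf{W}_1\tilde{\mathbf{D}}^{-1}\mathbf{b}(\boldsymbol{\zeta})$ is written $\mathbf{u}(\boldsymbol{\zeta})=\sum_{t=1}^T\boldsymbol{\Theta}_t\boldsymbol{\zeta}_t+\boldsymbol{\nu}$ with $\boldsymbol{\Theta}_t\in\mathbb{R}^{m\times N_u}$, $\boldsymbol{\nu}\in\mathbb{R}^m$. The $i$-th rows of $\mathbf{W}_1,\mathbf{W}_2,\boldsymbol{\Theta}_k$ are denoted $\mathbf{w}_{1,i},\mathbf{w}_{2,i},\boldsymbol{\theta}_{k,i}$. Adaptive robust problem: maximize $\log\det\mathbf{E}$ over $\mathbf{E}\succeq0$, $\mathbf{e}\in\mathbb{R}^T$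 such that for all $\boldsymbol{\xi}\in\mathbb{R}^T$ with $\|\boldsymbol{\xi}\|\le1$ and all $\boldsymbol{\zeta}$ with $\|\boldsymbol{\zeta}_t\|\le1$ ($t=1,\dots,T$) there is $\mathbf{y}\in\mathbb{R}^{(n-1)T}$ with $\mathbf{W}_1\tilde{\mathbf{D}}^{-1}(\mathbf{E}\boldsymbol{\xi}+\mathbf{e})+\mathbf{W}_2\mathbf{y}\le\mathbf{u}(\boldsymbol{\zeta})$. *)

(* Defs.v *)
From HB Require Import structures.
From mathcomp Require Import all_boot all_order all_algebra.
From mathcomp Require Import all_classical all_reals all_analysis.

Set Implicit Arguments.
Unset Strict Implicit.
Unset Printing Implicit Defensive.

Import Order.TTheory GRing.Theory Num.Theory.
Local Open Scope classical_set_scope.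
Local Open Scope ring_scope.

(* Dimension of each uncertainty vector zeta_t. *)
Definition Nu : nat := 3.

(* The norm that MathComp-Analysis puts on matrices is the sup norm, so the
   Euclidean norm is defined here. It is only used on row and column vectors;
   the two-index sum serves both shapes. *)
Definition norm2 (R : realType) (p q : nat) (v : 'M[R]_(p, q)) : R :=
  Num.sqrt (\sum_i \sum_j v i j ^+ 2).

Definition lecv (R : realType) (p : nat) (u v : 'cV[R]_p) : Prop :=
  forall i, u i 0 <= v i 0.

Definition possemidef (R : realType) (p : nat) (E : 'M[R]_p) : Prop :=
  E^T = E /\ forall x : 'cV[R]_p, 0 <= (x^T *m E *m x) 0 0.

Definition logdet (R : realType) (p : nat) (E : 'M[R]_p) : \bar R :=
  if \det E == 0 then -oo%E else (ln (\det E))%:E.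

Definition is_affine (R : realType) (U V : lmodType R) (f : U -> V) : Prop :=
  exists (l : {linear U -> V}) (c : V), forall x, f x = l x + c.

Definition orthogonal_basis (R : realType) (N : nat)
    (bs : N.-tuple 'cV[R]_N) : Prop :=
  basis_of fullv bs /\
  forall i j : 'I_N, i != j -> ((tnth bs i)^T *m tnth bs j) 0 0 = 0.

(* [time j] is the time to which column j belongs; each time owns exactly n of
   the n * T columns. Leaving the map arbitrary covers every ordering of the
   coordinates of R^(nT), e.g. time by time or component by component. *)
Definition time_labelling (n T : nat) (time : 'I_(n * T) -> 'I_T) : Prop :=
  forall t, #|[pred j | time j == t]| = n.

Definition time_structured (R : realType) (n T : nat)
    (time : 'I_(n * T) -> 'I_T) (D : 'M[R]_(T, n * T)) : Prop :=
  forall t j, D t j != 0 -> time j = t.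

Definition basis_mx1 (R : realType) (n T : nat)
    (bs : (n * T).-tuple 'cV[R]_(n * T)) : 'M[R]_(n * T, T) :=
  \matrix_(i, j) (bs`_j) i 0.

(* For 0 < n the indices T + j with j < n.-1 * T are those of the last
   (n - 1) T vectors of the basis. *)
Definition basis_mx2 (R : realType) (n T : nat)
    (bs : (n * T).-tuple 'cV[R]_(n * T)) : 'M[R]_(n * T, n.-1 * T) :=
  \matrix_(i, j) (bs`_(T + j)) i 0.

Record decision (R : realType) (n T : nat) := Decision {
  dE : 'M[R]_T;
  de : 'cV[R]_T;
  dK : 'M[R]_(n.-1 * T, T);
  dL : 'I_T -> 'M[R]_(n.-1 * T, Nu);
  dgamma : 'cV[R]_(n.-1 * T) }.

Definition affine_policy (R : realType) (n T : nat) (x : decision R n T)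
    (xi : 'cV[R]_T) (zeta : {ffun 'I_T -> 'cV[R]_Nu}) : 'cV[R]_(n.-1 * T) :=
  dK x *m xi + \sum_t dL x t *m zeta t + dgamma x.

Definition robust_constraint (R : realType) (n T m : nat)
    (W1 : 'M[R]_(m, T)) (W2 : 'M[R]_(m, n.-1 * T)) (Dt : 'M[R]_T)
    (Theta : 'I_T -> 'M[R]_(m, Nu)) (nu : 'cV[R]_m)
    (E : 'M[R]_T) (e : 'cV[R]_T) (xi : 'cV[R]_T)
    (zeta : {ffun 'I_T -> 'cV[R]_Nu}) (y : 'cV[R]_(n.-1 * T)) : Prop :=
  lecv (W1 *m invmx Dt *m (E *m xi + e) + W2 *m y)
       (\sum_t Theta t *m zeta t + nu).

Definition policy_feasible (R : realType) (n T m : nat)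
    (W1 : 'M[R]_(m, T)) (W2 : 'M[R]_(m, n.-1 * T)) (Dt : 'M[R]_T)
    (Theta : 'I_T -> 'M[R]_(m, Nu)) (nu : 'cV[R]_m)
    (x : decision R n T) : Prop :=
  possemidef (dE x) /\
  forall (xi : 'cV[R]_T) (zeta : {ffun 'I_T -> 'cV[R]_Nu}),
    norm2 xi <= 1 -> (forall t, norm2 (zeta t) <= 1) ->
    robust_constraint W1 W2 Dt Theta nu (dE x) (de x) xi zeta
      (affine_policy x xi zeta).

Definition conic_feasible (R : realType) (n T m : nat)
    (W1 : 'M[R]_(m, T)) (W2 : 'M[R]_(m, n.-1 * T)) (Dt : 'M[R]_T)
    (Theta : 'I_T -> 'M[R]_(m, Nu)) (nu : 'cV[R]_m)
    (x : decision R n T) (alpha : 'I_m -> R) : Prop :=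
  possemidef (dE x) /\
  forall i : 'I_m,
    norm2 (row i W1 *m invmx Dt *m dE x + row i W2 *m dK x)
      + \sum_k norm2 (row i W2 *m dL x k - row i (Theta k)) <= alpha i /\
    alpha i + (row i W1 *m invmx Dt *m de x) 0 0
      + (row i W2 *m dgamma x) 0 0 - nu i 0 <= 0.

Definition policy_value (R : realType) (n T m : nat)
    (W1 : 'M[R]_(m, T)) (W2 : 'M[R]_(m, n.-1 * T)) (Dt : 'M[R]_T)
    (Theta : 'I_T -> 'M[R]_(m, Nu)) (nu : 'cV[R]_m) : \bar R :=
  ereal_sup [set logdet (dE x) | x in
    [set x : decision R n T | policy_feasible W1 W2 Dt Theta nu x]].

Definition conic_value (R : realType) (n T m : nat)
    (W1 : 'M[R]_(m, T)) (W2 : 'M[R]_(m, n.-1 * T)) (Dt : 'M[R]_T)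
    (Theta : 'I_T -> 'M[R]_(m, Nu)) (nu : 'cV[R]_m) : \bar R :=
  ereal_sup [set logdet (dE xa.1) | xa in
    [set xa : decision R n T * ('I_m -> R) |
      conic_feasible W1 W2 Dt Theta nu xa.1 xa.2]].

(* Main.v *)
Require Import Defs.
From HB Require Import structures.
From mathcomp Require Import all_boot all_order all_algebra.
From mathcomp Require Import all_classical all_reals all_analysis.
From mathcomp Require Import ring lra.

Set Implicit Arguments.
Unset Strict Implicit.
Unset Printing Implicit Defensive.

Import Order.TTheory GRing.Theory Num.Theory.
Local Open Scope ring_scope.

(** The robust constraint is a system of m scalar inequalities, one per row of
    the matrices. Once the affine policy is substituted, the i-th inequality
    reads
      a xi + \sum_k c_k zeta_k + d <= 0,
    where a = w_{1,i} Dt^-1 E + w_{2,i} K, c_k = w_{2,i} L_k - theta_{k,i} and d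
    collects the terms free of xi and zeta ([row_residual]). The vectors xi,
    zeta_1, ..., zeta_T range independently over unit balls, so the left-hand
    side is largest when each linear form is, separately. The maximum of
    x |-> a x over the unit ball is the Euclidean norm of a: it is an upper
    bound by the Cauchy-Schwarz inequality ([mulmx_le_norm2]) and it is attained
    at a^T / |a| ([norm2_attained]). Hence the robust inequality is equivalent
    to |a| + \sum_k |c_k| + d <= 0 ([robust_linear_leP]), and alpha_i is a slack
    that splits this inequality in two; alpha_i = |a| + \sum_k |c_k| always
    works.

    The objective depends on E only, and both problems admit the same E, so
    their optimal values are suprema of the same set. *)

Lemma norm2_ge0 (R : realType) p q (v : 'M[R]_(p, q)) : 0 <= norm2 v.
Proof. exact: sqrtr_ge0. Qed.

Lemma sqr_norm2 (R : realType) p q (v : 'M[R]_(p, q)) :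
  norm2 v ^+ 2 = \sum_i \sum_j v i j ^+ 2.
Proof.
by rewrite sqr_sqrtr//; do 2!apply: sumr_ge0 => ? _; exact: sqr_ge0.
Qed.

Lemma norm2_tr (R : realType) p q (v : 'M[R]_(p, q)) : norm2 v^T = norm2 v.
Proof.
rewrite /norm2 exchange_big; congr Num.sqrt.
by do 2!apply: eq_bigr => ? _; rewrite mxE.
Qed.

Lemma norm2Z (R : realType) p q (c : R) (v : 'M[R]_(p, q)) :
  norm2 (c *: v) = `|c| * norm2 v.
Proof.
rewrite -sqrtr_sqr /norm2 -sqrtrM ?sqr_ge0//; congr Num.sqrt.
rewrite mulr_sumr; apply: eq_bigr => i _.
by rewrite mulr_sumr; apply: eq_bigr => j _; rewrite mxE exprMn.
Qed.

Lemma norm2_eq0 (R : realType) p q (v : 'M[R]_(p, q)) :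
  norm2 v = 0 -> v = 0.
Proof.
move=> v0; have /eqP := sqr_norm2 v; rewrite v0 expr0n/= eq_sym.
rewrite psumr_eq0; last by move=> i _; apply: sumr_ge0 => j _; exact: sqr_ge0.
move=> /allP vi0; apply/matrixP => i j; rewrite mxE.
have := vi0 i (mem_index_enum i); rewrite psumr_eq0; last first.
  by move=> k _; exact: sqr_ge0.
by move=> /allP/(_ j (mem_index_enum j)); rewrite /= sqrf_eq0 => /eqP.
Qed.

Lemma row_mulmx_tr (R : realType) p (a : 'rV[R]_p) :
  (a *m a^T) 0 0 = norm2 a ^+ 2.
Proof.
rewrite sqr_norm2 big_ord1 mxE; apply: eq_bigr => j _.
by rewrite mxE expr2.
Qed.

(** The Cauchy-Schwarz inequality, in the one-sided form needed on the unit
    ball. With r = |a|, expanding 0 <= |a - r x^T|^2 and using |x| <= 1 gives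
    r (a x) <= r^2, and r can be cancelled unless a = 0. *)
Lemma mulmx_le_norm2 (R : realType) p (a : 'rV[R]_p) (x : 'cV[R]_p) :
  norm2 x <= 1 -> (a *m x) 0 0 <= norm2 a.
Proof.
move=> x1; have [/norm2_eq0 ->|a0] := eqVneq (norm2 a) 0.
  by rewrite mul0mx mxE norm2_ge0.
have a_gt0 : 0 < norm2 a by rewrite lt_neqAle eq_sym a0 norm2_ge0.
have x2 : norm2 x ^+ 2 <= 1 by rewrite expr_le1 ?norm2_ge0.
have expand r : norm2 (a - r *: x^T) ^+ 2 =
    norm2 a ^+ 2 - 2 * r * (a *m x) 0 0 + r ^+ 2 * norm2 x ^+ 2.
  rewrite -(norm2_tr x) -!row_mulmx_tr trmxK !mxE !mulr_sumr -sumrB -big_split.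
  by apply: eq_bigr => j _ /=; rewrite !mxE; ring.
have := sqr_ge0 (norm2 (a - norm2 a *: x^T)); rewrite expand => sq_ge0.
rewrite -(ler_pM2l a_gt0); nra.
Qed.

(** When a = 0 the same witness applies: the inverse of 0 is 0, so it is the
    zero vector. *)
Lemma norm2_attained (R : realType) p (a : 'rV[R]_p) :
  exists2 x : 'cV[R]_p, norm2 x <= 1 & (a *m x) 0 0 = norm2 a.
Proof.
exists ((norm2 a)^-1 *: a^T).
  rewrite norm2Z norm2_tr ger0_norm ?invr_ge0 ?norm2_ge0//.
  have [->|a0] := eqVneq (norm2 a) 0; first by rewrite mulr0.
  by rewrite mulVf.
rewrite -scalemxAr mxE row_mulmx_tr expr2 mulrA.
have [->|a0] := eqVneq (norm2 a) 0; first by rewrite mulr0.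
by rewrite mulVf// mul1r.
Qed.

(** The worst case over a product of unit balls decouples into one worst case
    per ball, which yields the sum of the norms. *)
Lemma robust_linear_leP (R : realType) (p q : nat) (I : finType)
    (a : 'rV[R]_p) (c : I -> 'rV[R]_q) (d : R) :
  (forall (x : 'cV[R]_p) (z : {ffun I -> 'cV[R]_q}),
     norm2 x <= 1 -> (forall k, norm2 (z k) <= 1) ->
     (a *m x) 0 0 + \sum_k (c k *m z k) 0 0 + d <= 0) <->
  norm2 a + \sum_k norm2 (c k) + d <= 0.
Proof.
split=> [robust|le0 x z x1 z1].
  have [x x1 <-] := norm2_attained a.
  have /choice[z zP] : forall k, exists z : 'cV[R]_q,
      norm2 z <= 1 /\ (c k *m z) 0 0 = norm2 (c k).
    by move=> k; have [z ? ?] := norm2_attained (c k); exists z.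
  have -> : \sum_k norm2 (c k) = \sum_k (c k *m [ffun k => z k] k) 0 0.
    by apply: eq_bigr => k _; rewrite ffunE (zP k).2.
  by apply: robust => // k; rewrite ffunE (zP k).1.
apply: le_trans le0; rewrite lerD2r lerD ?mulmx_le_norm2//.
by apply: ler_sum => k _; exact: mulmx_le_norm2.
Qed.

Lemma row_residual (R : realType) (n T m : nat)
    (W1 : 'M[R]_(m, T)) (W2 : 'M[R]_(m, n.-1 * T)) (Dt : 'M[R]_T)
    (Theta : 'I_T -> 'M[R]_(m, Nu)) (nu : 'cV[R]_m) (x : decision R n T)
    (xi : 'cV[R]_T) (zeta : {ffun 'I_T -> 'cV[R]_Nu}) (i : 'I_m) :
  (W1 *m invmx Dt *m (dE x *m xi + de x) + W2 *m affine_policy x xi zeta) i 0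
    - (\sum_t Theta t *m zeta t + nu) i 0 =
  ((row i W1 *m invmx Dt *m dE x + row i W2 *m dK x) *m xi) 0 0
    + \sum_k ((row i W2 *m dL x k - row i (Theta k)) *m zeta k) 0 0
    + ((row i W1 *m invmx Dt *m de x) 0 0
       + (row i W2 *m dgamma x) 0 0 - nu i 0).
Proof.
have rowE p (v : 'cV[R]_p) k : v k 0 = row k v 0 0 by rewrite mxE.
have entryD (u v : 'M[R]_1) : (u + v) 0 0 = u 0 0 + v 0 0 by rewrite mxE.
have -> : \sum_k ((row i W2 *m dL x k - row i (Theta k)) *m zeta k) 0 0 =
    (row i W2 *m \sum_k dL x k *m zeta k) 0 0
    - (row i (\sum_k Theta k *m zeta k)) 0 0.
  rewrite -rowE mulmx_sumr !summxE -sumrB; apply: eq_bigr => k _.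
  by rewrite mulmxBl mulmxA (rowE _ (Theta k *m _)) row_mul !mxE.
rewrite (rowE _ (_ + _ *m affine_policy _ _ _)) (rowE _ (_ + nu)) (rowE _ nu).
rewrite /affine_policy !raddfD /= !row_mul !mulmxDl !mulmxA.
rewrite !entryD; ring.
Qed.

Theorem theorem2 (R : realType) (T n m : nat)
  (T_gt0 : (0 < T)%N) (n_gt0 : (0 < n)%N) (m_gt0 : (0 < m)%N)
  (W : 'M[R]_(m, n * T)) (D : 'M[R]_(T, n * T))
  (time : 'I_(n * T) -> 'I_T)
  (time_lab : time_labelling time)
  (D_time : time_structured time D)
  (D_rank : \rank D = T)
  (z : {ffun 'I_T -> 'cV[R]_Nu} -> 'cV[R]_m) (z_affine : is_affine z)
  (b : {ffun 'I_T -> 'cV[R]_Nu} -> 'cV[R]_T) (b_affine : is_affine b)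
  (bs : (n * T).-tuple 'cV[R]_(n * T))
  (bs_basis : orthogonal_basis bs)
  (bs_null : forall x : 'cV[R]_(n * T),
    (x \in <<drop T bs>>%VS) = (D *m x == 0))
  (Dt : 'M[R]_T) (Dt_def : Dt = D *m basis_mx1 bs)
  (W1 : 'M[R]_(m, T)) (W1_def : W1 = W *m basis_mx1 bs)
  (W2 : 'M[R]_(m, n.-1 * T)) (W2_def : W2 = W *m basis_mx2 bs)
  (Theta : 'I_T -> 'M[R]_(m, Nu)) (nu : 'cV[R]_m)
  (u_def : forall zeta : {ffun 'I_T -> 'cV[R]_Nu},
    z zeta + W1 *m invmx Dt *m b zeta = \sum_t Theta t *m zeta t + nu) :
  (forall x : decision R n T,
     policy_feasible W1 W2 Dt Theta nu x <->
     exists alpha : 'I_m -> R, conic_feasible W1 W2 Dt Theta nu x alpha) /\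
  policy_value W1 W2 Dt Theta nu = conic_value W1 W2 Dt Theta nu.
Proof.
have feasP (x : decision R n T) : policy_feasible W1 W2 Dt Theta nu x <->
    exists alpha : 'I_m -> R, conic_feasible W1 W2 Dt Theta nu x alpha.
  split=> [[psd robust]|[alpha [psd conic]]].
    (* The smallest admissible alpha makes the first inequality an equality. *)
    exists (fun i => norm2 (row i W1 *m invmx Dt *m dE x + row i W2 *m dK x)
      + \sum_k norm2 (row i W2 *m dL x k - row i (Theta k))).
    split=> // i; split=> //; rewrite -2!addrA [X in _ + X]addrA.
    apply/robust_linear_leP => xi zeta xi1 zeta1.
    by rewrite -row_residual subr_le0; exact: robust.
  split=> // xi zeta xi1 zeta1 i; rewrite -subr_le0 row_residual.
  move: xi zeta xi1 zeta1; apply/robust_linear_leP.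
  have [norm_le alpha_le] := conic i.
  by apply: le_trans alpha_le; rewrite !addrA !lerD2r.
split=> //; congr ereal_sup; apply/seteqP; split=> y /=.
  by move=> [x /feasP[alpha conic] <-]; exists (x, alpha).
by move=> [[x alpha] /= conic <-]; exists x => //; apply/feasP; exists alpha.
Qed.
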